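(* Let $n\in\mathbb{N}$, $\Delta T>0$, $D\subset\mathbb{R}^{2n}$, and let $\Phi^{\Delta T}:D\to\mathbb{R}^{2n}$ be the time-$\Delta T$ flow map of a Hamiltonian system. Let $\Omega:=\{I_1x_0+I_2\Phi^{\Delta T}(x_0):x_0\in D\}$ be open and convex, and let $S^{\Delta T}\in C^2(\Omega)\cap H_k(\Omega)$ be a type II generating function of $\Phi^{\Delta T}$ on $\Omega$ (see context). Let $u:=S^{\Delta T}$ and run the gradient Hermite–Birkhoff $f$-greedy algorithm (see context) with index set $\mathcal J=\{1,\dots,2n\}$, producing selected pairs $(x_i,\ell_i)$, surrogates $s_i$ and errors $e_i=S^{\Delta T}-s_i$. For each $m\ge1$ choose $i_m\in\{m+1,\dots,2m\}$ with $\|\nabla e_{i_m}\|_{L^\infty(\Omega)}=\min_{m+1\le i\le 2m}\|\nabla e_i\|_{L^\infty(\Omega)}$. Fix a compact set $K\subset\mathbb{R}^{2n}$ and assume: (i) (Uniform solvability) for every $x_0\in K$ and every $m$ sufficiently large, the implicit equations $y=x_0+\Delta T J_{2n}\nabla S^{\Delta T}(I_1x_0+I_2y)$ and $y=x_0+\Delta T J_{2n}\nabla s_{i_m}(I_1x_0+I_2y)$ have unique solutions $y^\ast=\Phi^{\Delta T}(x_0)$ and $y_m=:x_{\Delta T,i_m}(x_0)$ respectively, with $I_1x_0+I_2y^\ast\in\Omega$ and $I_1x_0+I_2y_m\in\Omega$; (ii) (Uniform Lipschitz continuity in $y$) there is $L_S>0$ with $\sup_{x_0\in K,\ y:\ I_1x_0+I_2y\in\Omega}\|\nabla^2S^{\Delta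 T}(I_1x_0+I_2y)\,I_2\|_2=L_S<\infty$. Assume $\Delta T<1/L_S$. Then there exists a constant $C>0$, independent of $m$ and $x_0$, such that (for all $m$ sufficiently large as in (i)) \[ \sup_{x_0\in K}\|x_{\Delta T,i_m}(x_0)-\Phi^{\Delta T}(x_0)\|_2\le C\,\Delta T\,\sqrt{2n}\,m^{-1/2}\,\|e_{m+1}\|_{H_k(\Omega)}\left[\prod_{i=m+1}^{2m}P_i(x_{i+1},\ell_{i+1})\right]^{1/m}. \]
   Context: $J_{2n}=\begin{bmatrix}0_n&I_n\\-I_n&0_n\end{bmatrix}$; $I_1=\begin{bmatrix}I_n&0\\0&0\end{bmatrix}$, $I_2=\begin{bmatrix}0&0\\0&I_n\end{bmatrix}$. A Hamiltonian system is $\dot x=J_{2n}\nabla\mathcal H(x)$ for $x=(q,p)\in\mathbb{R}^{2n}$, and $\Phi^{\Delta T}(x_0)$ is its solution at time $\Delta T$ with initial value $x_0$. A type II generating function of $\Phi^{\Delta T}$ on $\Omega$ is a function $S^{\Delta T}\in H_k(\Omega)\cap C^1(\Omega)$ with $J_{2n}^\top\frac{\Phi^{\Delta T}(x_0)-x_0}{\Delta T}=\nabla S^{\Delta T}(I_1x_0+I_2\Phi^{\Delta T}(x_0))$ for all $x_0\in D$. Kernel assumptions: $k$ is a symmetric positive definite kernel on $\Omega$ with RKHS $H_k(\Omega)$, $k\in C^2(\Omega\times\Omega)$, and for all $x\in\Omega$, $\ell\in\mathcal J$, $\partial^{(2)}_\ell k(\cdot,x)\in H_k(\Omega)$ with $\partial_\ell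 f(x)=\langle f,\partial^{(2)}_\ell k(\cdot,x)\rangle_{H_k(\Omega)}$ for all $f\in H_k(\Omega)$ ($\partial^{(2)}_\ell$ = derivative in the second argument). Greedy algorithm: for a selection $\{(x_i,\ell_i)\}_{i=1}^m\subset\Omega\times\mathcal J$, $V_m:=\operatorname{span}\{\partial^{(2)}_{\ell_i}k(\cdot,x_i)\}_{i=1}^m$ ($V_0=\{0\}$), $\Pi_m$ the orthogonal projector of $H_k(\Omega)$ onto $V_m$, $s_m:=\Pi_m u$, $e_m:=u-s_m$; starting from $m=0$, for each $m\ge0$ choose $(x_{m+1},\ell_{m+1})\in\operatorname{argmax}_{x\in\Omega,\ell\in\mathcal J}|\partial_\ell e_m(x)|$ (maximizers assumed to exist). Power function: $P_m(x,\ell):=\|(I-\Pi_m)\partial^{(2)}_\ell k(\cdot,x)\|_{H_k(\Omega)}$. $\|\nabla e\|_{L^\infty(\Omega)}:=\sup_{x\in\Omega}\|\nabla e(x)\|_2$. *)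

(* Defs.v *)
From HB Require Import structures.
From mathcomp Require Import all_boot all_order all_algebra.
From mathcomp Require Import all_classical all_reals all_analysis.
From Stdlib Require Import ClassicalEpsilon.

Set Implicit Arguments.
Unset Strict Implicit.
Unset Printing Implicit Defensive.

Import Order.TTheory GRing.Theory Num.Theory.
Import numFieldNormedType.Exports.
Local Open Scope classical_set_scope.
Local Open Scope ring_scope.

Section Defs.
Variable R : realType.

Notation V d := 'rV[R]_d.

Definition vnorm2 d (v : V d) : R := Num.sqrt (\sum_(i < d) (v 0 i) ^+ 2).

(* Spectral norm of a matrix, acting on column vectors: sup_{||v||_2<=1} ||A v||_2 *)
Definition opnorm2 d (A : 'M[R]_d) : R :=
  sup [set vnorm2 (v *m A^T) | v in [set v : V d | vnorm2 v <= 1]].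

Definition pd d (f : V d -> R) (l : 'I_d) (x : V d) : R := derive f x (delta_mx 0 l).

Definition gradf d (f : V d -> R) (x : V d) : V d := \row_l pd f l x.

Definition hess d (f : V d -> R) (x : V d) : 'M[R]_d := \matrix_(i, j) pd (pd f j) i x.

Definition C1_on d (A : set (V d)) (f : V d -> R) : Prop :=
  (forall x, A x -> differentiable f x) /\ (forall l, {within A, continuous (pd f l)}).
Definition C2_on d (A : set (V d)) (f : V d -> R) : Prop :=
  C1_on A f /\ forall l, C1_on A (pd f l).

Definition convex_rv d (A : set (V d)) : Prop :=
  forall a b t, A a -> A b -> 0 <= t <= 1 -> A ((1 - t) *: a + t *: b).

(* Symplectic structure on R^{2n} = R^{n+n}, x = (q,p) *)
Definition Jmx n : 'M[R]_(n + n) := block_mx 0 1%:M (- 1%:M) 0.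
Definition Japp n (v : V (n + n)) : V (n + n) := v *m (Jmx n)^T.
Definition JTapp n (v : V (n + n)) : V (n + n) := v *m Jmx n.
Definition I1 n (x : V (n + n)) : V (n + n) := row_mx (lsubmx x) 0.
Definition I2 n (x : V (n + n)) : V (n + n) := row_mx 0 (rsubmx x).
Definition I2mx n : 'M[R]_(n + n) := block_mx 0 0 0 1%:M.

Definition hamiltonian_flow n (Ham : V (n + n) -> R) (dT : R) (D : set (V (n + n)))
  (Phi : V (n + n) -> V (n + n)) : Prop :=
  forall x0, D x0 -> exists gam : R -> V (n + n),
    gam 0 = x0 /\ gam dT = Phi x0 /\
    {within [set t | 0 <= t <= dT], continuous gam} /\
    (forall t, 0 < t < dT -> is_derive t 1 gam (Japp (gradf Ham (gam t)))).

Definition Omega n (D : set (V (n + n))) (Phi : V (n + n) -> V (n + n)) : set (V (n + n)) :=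
  [set I1 x0 + I2 (Phi x0) | x0 in D].

(* Type II generating function of Phi on Omega (membership in H_k and C^1 are
   stated separately). *)
Definition type2_genfun n (D : set (V (n + n))) (Phi : V (n + n) -> V (n + n)) (dT : R)
  (S : V (n + n) -> R) : Prop :=
  forall x0, D x0 -> dT^-1 *: JTapp (Phi x0 - x0) = gradf S (I1 x0 + I2 (Phi x0)).

(* H is a set of (representatives of) functions on Omega, ip its inner product. *)
Definition rnorm d (ip : (V d -> R) -> (V d -> R) -> R) (f : V d -> R) : R :=
  Num.sqrt (ip f f).

Definition is_RKHS d (Om : set (V d)) (k : V d -> V d -> R) (H : set (V d -> R))
  (ip : (V d -> R) -> (V d -> R) -> R) : Prop :=
  H (fun _ => 0) /\
      (forall f g, H f -> H g -> H (fun y => f y + g y)) /\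
      (forall (a : R) f, H f -> H (fun y => a * f y)) /\
      (forall f g h a, H f -> H g -> H h ->
          ip (fun y => a * f y + g y) h = a * ip f h + ip g h) /\
      (forall f g, H f -> H g -> ip f g = ip g f) /\
      (forall f, H f -> 0 <= ip f f /\ (ip f f = 0 -> forall x, Om x -> f x = 0)) /\
      (forall u : nat -> V d -> R, (forall i, H (u i)) ->
         (forall e, 0 < e -> exists N, forall i j, (N <= i)%N -> (N <= j)%N ->
            rnorm ip (fun y => u i y - u j y) < e) ->
         exists f, H f /\ forall e, 0 < e -> exists N, forall i, (N <= i)%N ->
            rnorm ip (fun y => u i y - f y) < e) /\
      (forall x, Om x -> H (fun y => k y x) /\ forall f, H f -> f x = ip f (fun y => k y x)).

Definition spd_kernel d (Om : set (V d)) (k : V d -> V d -> R) : Prop :=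
  (forall x y, Om x -> Om y -> k x y = k y x) /\
  (forall (N : nat) (pts : 'I_N -> V d) (c : 'I_N -> R),
     (forall i, Om (pts i)) -> injective pts -> (exists i, c i != 0) ->
     0 < \sum_(i < N) \sum_(j < N) c i * c j * k (pts i) (pts j)).

Definition dk2 d (k : V d -> V d -> R) (l : 'I_d) (x : V d) : V d -> R :=
  fun y => pd (fun z => k y z) l x.

Definition kernel_C2 d (Om : set (V d)) (k : V d -> V d -> R) : Prop :=
  C2_on [set z : V (d + d) | Om (lsubmx z) /\ Om (rsubmx z)]
        (fun z => k (lsubmx z) (rsubmx z)).

Definition deriv_reproducing d (Om : set (V d)) (k : V d -> V d -> R) (H : set (V d -> R))
  (ip : (V d -> R) -> (V d -> R) -> R) : Prop :=
  forall x l, Om x -> H (dk2 k l x) /\ forall f, H f -> pd f l x = ip f (dk2 k l x).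

Definition in_span d (g : nat -> V d -> R) (m : nat) (p : V d -> R) : Prop :=
  exists c : nat -> R, forall y, p y = \sum_(1 <= i < m.+1) c i * g i y.

Definition is_proj d (ip : (V d -> R) -> (V d -> R) -> R) (g : nat -> V d -> R) (m : nat)
  (f p : V d -> R) : Prop :=
  in_span g m p /\ forall i, (1 <= i <= m)%N -> ip (fun y => f y - p y) (g i) = 0.

Definition proj d (ip : (V d -> R) -> (V d -> R) -> R) (g : nat -> V d -> R) (m : nat)
  (f : V d -> R) : V d -> R :=
  epsilon (inhabits (fun _ : V d => (0 : R))) (is_proj ip g m f).

(* greedy data: selected pairs (x_i, l_i), i >= 1 *)
Definition gsel d (k : V d -> V d -> R) (xs : nat -> V d) (ls : nat -> 'I_d) : nat -> V d -> R :=
  fun i => dk2 k (ls i) (xs i).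

Definition surr d (ip : (V d -> R) -> (V d -> R) -> R) (k : V d -> V d -> R)
  (xs : nat -> V d) (ls : nat -> 'I_d) (u : V d -> R) (m : nat) : V d -> R :=
  proj ip (gsel k xs ls) m u.
Definition err d (ip : (V d -> R) -> (V d -> R) -> R) (k : V d -> V d -> R)
  (xs : nat -> V d) (ls : nat -> 'I_d) (u : V d -> R) (m : nat) : V d -> R :=
  fun y => u y - surr ip k xs ls u m y.

Definition power d (ip : (V d -> R) -> (V d -> R) -> R) (k : V d -> V d -> R)
  (xs : nat -> V d) (ls : nat -> 'I_d) (m : nat) (x : V d) (l : 'I_d) : R :=
  let g := dk2 k l x in
  rnorm ip (fun y => g y - proj ip (gsel k xs ls) m g y).

Definition fgreedy d (Om : set (V d)) (ip : (V d -> R) -> (V d -> R) -> R)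
  (k : V d -> V d -> R) (u : V d -> R) (xs : nat -> V d) (ls : nat -> 'I_d) : Prop :=
  forall m : nat, Om (xs m.+1) /\
    forall x l, Om x ->
      `| pd (err ip k xs ls u m) l x | <= `| pd (err ip k xs ls u m) (ls m.+1) (xs m.+1) |.

Definition Linf_grad d (Om : set (V d)) (e : V d -> R) : \bar R :=
  ereal_sup [set (vnorm2 (gradf e x))%:E | x in Om].

End Defs.

(* Main.v *)
Require Import Defs.
From HB Require Import structures.
From mathcomp Require Import all_boot all_order all_algebra.
From mathcomp Require Import all_classical all_reals all_analysis.
From mathcomp Require Import ring.
From Stdlib Require Import ClassicalEpsilon.
Import Order.TTheory GRing.Theory Num.Theory.
Import numFieldNormedType.Exports.
Local Open Scope classical_set_scope.
Local Open Scope ring_scope.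

Set Implicit Arguments.
Unset Strict Implicit.
Unset Printing Implicit Defensive.

(** The greedy derivative |d_l e_i(x)| at the selected pair equals the inner
product of [e_i] with the part of the next generator orthogonal to [V_i].
Optimality of the projection then bounds its square by P_i^2 times the energy
drop |e_i|^2 - |e_(i+1)|^2. Multiplying over i = m+1, ..., 2m, the energy drops
telescope after AM-GM, so one of these derivatives is at most
m^(-1/2) |e_(m+1)| times the geometric mean of the P_i.

Subtracting the two implicit equations, |y_m - y| is at most dT times
|grad e_(i_m)|_oo plus dT times |grad S(z_m) - grad S(z)|. The last factor is
at most L_S |y_m - y| by the mean value theorem along the segment, which stays
in the convex set [Omega]; it is absorbed because dT L_S < 1, giving
C = 1/(1 - dT L_S). The mean value theorem produces the transpose of the matrix
in hypothesis (ii), hence the need for the symmetry of the Hessian. *)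

(** * Orthogonal projection in a semidefinite inner product space *)

Section Projection.
Context (R : realType) (d : nat).
Local Notation V := 'rV[R]_d.
Context (Om : set V) (k : V -> V -> R) (H : set (V -> R)).
Context (ip : (V -> R) -> (V -> R) -> R).
Hypothesis rkH : is_RKHS Om k H ip.
Implicit Types (f g h p q w : V -> R) (G : nat -> V -> R) (m : nat).

Lemma RKHS_lin a f g : H f -> H g -> H (fun y => a * f y + g y).
Proof. case: rkH => _ [HD [HZ _]] Hf Hg; exact: (HD _ _ (HZ a f Hf) Hg). Qed.

Lemma RKHS_sub f g : H f -> H g -> H (fun y => f y - g y).
Proof.
move=> Hf Hg; rewrite (_ : (fun y => _) = fun y => (-1) * g y + f y).
  exact: RKHS_lin.
by apply/funext => y; ring.
Qed.

Lemma ip_sym f g : H f -> H g -> ip f g = ip g f.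
Proof. by case: rkH => _ [_ [_ [_ [+ _]]]]; apply. Qed.

Lemma ip_ge0 f : H f -> 0 <= ip f f.
Proof. by case: rkH => _ [_ [_ [_ [_ [+ _]]]]] => /[apply]; case. Qed.

Lemma ip_linl a f g h : H f -> H g -> H h ->
  ip (fun y => a * f y + g y) h = a * ip f h + ip g h.
Proof. by case: rkH => _ [_ [_ [+ _]]]; apply. Qed.

Lemma ip_linr a f g h : H f -> H g -> H h ->
  ip h (fun y => a * f y + g y) = a * ip h f + ip h g.
Proof.
move=> Hf Hg Hh; rewrite ip_sym ?ip_linl //; last exact: RKHS_lin.
by rewrite (ip_sym Hf) // (ip_sym Hg).
Qed.

Lemma ip_subl f g h : H f -> H g -> H h ->
  ip (fun y => f y - g y) h = ip f h - ip g h.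
Proof.
move=> Hf Hg Hh; rewrite (_ : (fun y => _) = fun y => (-1) * g y + f y).
  by rewrite ip_linl //; ring.
by apply/funext => y; ring.
Qed.

Lemma ip_subr f g h : H f -> H g -> H h ->
  ip h (fun y => f y - g y) = ip h f - ip h g.
Proof.
move=> Hf Hg Hh; rewrite ip_sym ?ip_subl //; last exact: RKHS_sub.
by rewrite (ip_sym Hf) // (ip_sym Hg).
Qed.

Lemma ip_sq_lin a f g : H f -> H g ->
  ip (fun y => a * f y + g y) (fun y => a * f y + g y) =
  a ^+ 2 * ip f f + 2 * a * ip f g + ip g g.
Proof.
move=> Hf Hg; have Hl := RKHS_lin a Hf Hg.
rewrite ip_linl ?ip_linr // (ip_sym Hg Hf); ring.
Qed.

(** A null function is only known to vanish on [Om], so Cauchy-Schwarz has to dispose of it. If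
    [ip w h] were nonzero, the multiple of [h] chosen here, added to [w], would have energy -1. *)
Lemma ip_null h w : H h -> H w -> ip h h = 0 -> ip w h = 0.
Proof.
move=> Hh Hw hh0; apply/eqP/negPn/negP => wh0.
have := ip_ge0 (RKHS_lin (- (ip w w + 1) / (2 * ip w h)) Hh Hw).
rewrite ip_sq_lin // hh0 (ip_sym Hh Hw) => le0.
suff : 0 <= (- 1 : R) by rewrite oppr_ge0 ler10.
apply: le_trans le0 _; rewrite le_eqVlt; apply/orP; left; apply/eqP; field.
by rewrite wh0.
Qed.

Lemma in_span0 G : in_span G 0 (fun _ => 0).
Proof. by exists (fun _ => 0) => y; rewrite big_geq. Qed.

Lemma in_span_lin G m a f g :
  in_span G m f -> in_span G m g -> in_span G m (fun y => a * f y + g y).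
Proof.
move=> [c fE] [c' gE]; exists (fun i => a * c i + c' i) => y.
rewrite fE gE big_distrr -big_split /=; apply: eq_bigr => i _; ring.
Qed.

Lemma in_spanS G m f : in_span G m f -> in_span G m.+1 f.
Proof.
move=> [c fE]; exists (fun i => if (i <= m)%N then c i else 0) => y.
rewrite big_nat_recr //= ltnn mul0r addr0 fE.
by apply: eq_big_nat => i /andP[_]; rewrite ltnS => ->.
Qed.

Lemma in_span_gen G m : in_span G m.+1 (G m.+1).
Proof.
exists (fun i => (i == m.+1)%:R) => y; rewrite big_nat_recr //= eqxx mul1r.
rewrite big1_seq ?add0r // => i /andP[_]; rewrite mem_index_iota => /andP[_ im].
by rewrite ltn_eqF ?mul0r.
Qed.

Lemma in_span_RKHS G m p :
  (forall i, (1 <= i <= m)%N -> H (G i)) -> in_span G m p -> H p.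
Proof.
move=> HG [c] /funext ->; elim: m HG => [|m IH] HG.
  rewrite (_ : (fun _ => _) = fun=> 0); first by case: rkH.
  by apply/funext => y; rewrite big_geq.
rewrite (_ : (fun _ => _) = fun y => c m.+1 * G m.+1 y
    + \sum_(1 <= i < m.+1) c i * G i y).
  apply: RKHS_lin; first by apply: HG; rewrite ltnSn.
  by apply: IH => i /andP[i1 im]; apply: HG; rewrite i1 leqW.
by apply/funext => y; rewrite big_nat_recr //= addrC.
Qed.

Lemma ip_span_eq0 G m w p : (forall i, (1 <= i <= m)%N -> H (G i)) -> H w ->
  (forall i, (1 <= i <= m)%N -> ip w (G i) = 0) -> in_span G m p -> ip w p = 0.
Proof.
move=> HG Hw w0 [c] /funext ->; elim: m HG w0 => [|m IH] HG w0.
  rewrite (_ : (fun _ => _) = fun=> 0); last first.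
    by apply/funext => y; rewrite big_geq.
  have H0 : H (fun=> 0) by case: rkH.
  rewrite -[RHS](subrr (ip w (fun=> 0))) -(ip_subr H0 H0 Hw).
  by congr ip; apply/funext => y; rewrite subrr.
have HGm i : (1 <= i <= m)%N -> H (G i).
  by move=> /andP[i1 im]; apply: HG; rewrite i1 leqW.
rewrite (_ : (fun _ => _) = fun y => c m.+1 * G m.+1 y
    + \sum_(1 <= i < m.+1) c i * G i y); last first.
  by apply/funext => y; rewrite big_nat_recr //= addrC.
rewrite ip_linr //.
- rewrite w0 ?ltnSn // mulr0 add0r IH // => i /andP[i1 im].
  by rewrite w0 // i1 leqW.
- by apply: HG; rewrite ltnSn.
- by apply: (@in_span_RKHS G m) => //; exists c.
Qed.

(** Gram-Schmidt, by induction on [m] for all [f] at once, since the induction hypothesis also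
    projects [G m.+1]. With [h] the part of [G m.+1] orthogonal to the earlier generators, the new
    projection is the old one plus a multiple of [h]. The generators may be linearly dependent. *)
Lemma is_proj_exists G m f : (forall i, (1 <= i <= m)%N -> H (G i)) -> H f ->
  exists p, is_proj ip G m f p.
Proof.
elim: m f => [|m IH] f HG Hf.
  by exists (fun=> 0); split=> [|[]//]; exact: in_span0.
have HGm i : (1 <= i <= m)%N -> H (G i).
  by move=> /andP[i1 im]; apply: HG; rewrite i1 leqW.
have HG1 : H (G m.+1) by apply: HG; rewrite ltnSn.
have [p [pspan p0]] := IH f HGm Hf; have [q [qspan q0]] := IH _ HGm HG1.
have Hp := in_span_RKHS HGm pspan; have Hq := in_span_RKHS HGm qspan.
pose h y := G m.+1 y - q y; have Hh : H h := RKHS_sub HG1 Hq.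
have hspan : in_span G m.+1 h.
  rewrite (_ : h = fun y => (-1) * q y + G m.+1 y).
    exact: in_span_lin (in_spanS qspan) (in_span_gen _ _).
  by apply/funext => y; rewrite /h; ring.
(* Orthogonality to [G m.+1] will be split into orthogonality to [h], by the choice of [t], and to
   [q], which lies in the earlier span. *)
have hqE : G m.+1 = fun y => 1 * h y + q y by apply/funext => y; rewrite /h; ring.
have h0 i : (1 <= i <= m)%N -> ip h (G i) = 0 by exact: q0.
clearbody h; have He := RKHS_sub Hf Hp.
(* When [h] is null the quotient below is 0 and Cauchy-Schwarz gives the orthogonality. *)
pose t := ip (fun y => f y - p y) h / ip h h.
have teq : ip (fun y => f y - p y) h = t * ip h h.
  have [hh0|hh0] := eqVneq (ip h h) 0; last by rewrite divfK.
  by rewrite hh0 mulr0 ip_null.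
have Hn := RKHS_lin t Hh Hp.
have resE g : H g -> ip (fun y => f y - (t * h y + p y)) g =
    ip (fun y => f y - p y) g - t * ip h g.
  by move=> Hg; rewrite !ip_subl // ip_linl //; ring.
have res0 i : (1 <= i <= m)%N -> ip (fun y => f y - (t * h y + p y)) (G i) = 0.
  by move=> im; rewrite (resE _ (HGm _ im)) p0 // h0 // mulr0 subr0.
exists (fun y => t * h y + p y); split.
  exact: in_span_lin hspan (in_spanS pspan).
move=> i /andP[i1]; rewrite leq_eqVlt => /orP[/eqP ->|im]; last first.
  by apply: res0; rewrite i1.
rewrite hqE ip_linr //; last exact: RKHS_sub.
rewrite (ip_span_eq0 HGm _ res0 qspan) ?resE ?teq //; last exact: RKHS_sub.
by ring.
Qed.

Lemma projP G m f : (forall i, (1 <= i <= m)%N -> H (G i)) -> H f ->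
  is_proj ip G m f (Defs.proj ip G m f).
Proof. by move=> HG Hf; apply: epsilon_spec; exact: is_proj_exists. Qed.

(** Pythagoras: the difference of two elements of the span is orthogonal to the residual. [proj]
    picks one projection among possibly several that differ by null functions, so energies are
    compared through this bound. *)
Lemma proj_min G m f q : (forall i, (1 <= i <= m)%N -> H (G i)) -> H f ->
  in_span G m q ->
  ip (fun y => f y - Defs.proj ip G m f y) (fun y => f y - Defs.proj ip G m f y) <=
  ip (fun y => f y - q y) (fun y => f y - q y).
Proof.
move=> HG Hf qspan; have [pspan p0] := projP HG Hf.
set p := Defs.proj _ _ _ _ in pspan p0 *; set e := (fun y => f y - p y) in p0 *.
have Hp := in_span_RKHS HG pspan; have Hq := in_span_RKHS HG qspan.
have He : H e := RKHS_sub Hf Hp.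
have pqspan : in_span G m (fun y => (-1) * q y + p y) by exact: in_span_lin.
have Hpq := in_span_RKHS HG pqspan.
rewrite (_ : (fun y => f y - q y) = fun y => 1 * ((-1) * q y + p y) + e y).
  rewrite ip_sq_lin // (ip_sym Hpq He) (ip_span_eq0 HG He p0 pqspan).
  by rewrite expr1n mul1r mulr0 addr0 lerDr ip_ge0.
by apply/funext => y; rewrite /e; ring.
Qed.

Lemma proj_errS_le G m f : (forall i, (1 <= i <= m.+1)%N -> H (G i)) -> H f ->
  ip (fun y => f y - Defs.proj ip G m.+1 f y) (fun y => f y - Defs.proj ip G m.+1 f y) <=
  ip (fun y => f y - Defs.proj ip G m f y) (fun y => f y - Defs.proj ip G m f y).
Proof.
move=> HG Hf; apply: proj_min => //; apply: in_spanS.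
by apply projP => // i /andP[i1 im]; apply: HG; rewrite i1 leqW.
Qed.

(** The residual at [m.+1] is no larger than that of the competitor obtained by adding to the old
    projection the best multiple of [h], whose energy is [ip (e m) (e m)] minus
    [ip (e m) h ^+ 2 / ip h h]. *)
Lemma proj_err_decay G m f : (forall i, (1 <= i <= m.+1)%N -> H (G i)) -> H f ->
  let e j y := f y - Defs.proj ip G j f y in
  let h y := G m.+1 y - Defs.proj ip G m (G m.+1) y in
  is_true (ip (e m) (G m.+1) ^+ 2 <=
           ip h h * (ip (e m) (e m) - ip (e m.+1) (e m.+1))).
Proof.
move=> HG Hf e h.
have HGm i : (1 <= i <= m)%N -> H (G i).
  by move=> /andP[i1 im]; apply: HG; rewrite i1 leqW.
have HG1 : H (G m.+1) by apply: HG; rewrite ltnSn.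
have [pspan p0] := projP HGm Hf; have [qspan _] := projP HGm HG1.
have Hp := in_span_RKHS HGm pspan; have Hq := in_span_RKHS HGm qspan.
have He : H (e m) := RKHS_sub Hf Hp; have Hh : H h := RKHS_sub HG1 Hq.
(* The residual is orthogonal to the span containing the projection of [G m.+1]. *)
have -> : ip (e m) (G m.+1) = ip (e m) h.
  by rewrite /h ip_subr // (ip_span_eq0 HGm He p0 qspan) subr0.
have [hh0|hh0] := eqVneq (ip h h) 0; first by rewrite ip_null // hh0 expr0n mul0r.
have hh_gt0 : 0 < ip h h by rewrite lt_def hh0 ip_ge0.
set a := ip (e m) h.
have hspan : in_span G m.+1 h.
  rewrite (_ : h = fun y => (-1) * Defs.proj ip G m (G m.+1) y + G m.+1 y).
    exact: in_span_lin (in_spanS qspan) (in_span_gen _ _).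
  by apply/funext => y; rewrite /h; ring.
have := proj_min HG Hf (in_span_lin (a / ip h h) hspan (in_spanS pspan)).
rewrite -/(e m.+1) (_ : (fun y => f y - (_ + _)) =
  fun y => (- (a / ip h h)) * h y + e m y); last first.
  by apply/funext => y; rewrite /e; ring.
rewrite ip_sq_lin // (ip_sym Hh He) -/a.
rewrite [X in _ <= X](_ : _ = ip (e m) (e m) - a ^+ 2 / ip h h); last by field.
by rewrite lerBrDr addrC -lerBrDr ler_pdivrMr // mulrC.
Qed.

End Projection.

(** * Geometric mean bound from telescoping energy drops *)

Section Greedy.
Context (R : realType).

Lemma prod_nat_double (F : nat -> R) m :
  \prod_(m.+1 <= i < m.*2.+1) F i = \prod_(i < m) F (i + m.+1)%N.
Proof.
by rewrite -{1}[m.+1]add0n big_addn -addnn -addnS addnK big_mkord.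
Qed.

Lemma prod_le_mean_exp m (F : 'I_m -> R) : (forall i, 0 <= F i) ->
  \prod_(i < m) F i <= ((\sum_(i < m) F i) / m%:R) ^+ m.
Proof.
move=> F0; have [AGM _] := leif_AGM (A := 'I_m) (fun i _ => F0 i).
by rewrite card_ord in AGM.
Qed.

(** By contradiction: if all [m] values exceeded the bound [Q], the product of their squares would
    exceed [(Q ^+ 2) ^+ m], which the energy drops and AM-GM forbid. *)
Lemma exists_le_geometric_mean (a P E : nat -> R) (m : nat) : (0 < m)%N ->
  (forall i, 0 <= a i) -> (forall i, 0 <= P i) -> (forall i, 0 <= E i) ->
  (forall i, E i.+1 <= E i) ->
  (forall i, a i ^+ 2 <= P i ^+ 2 * (E i - E i.+1)) ->
  exists2 i, (m.+1 <= i <= m.*2)%N &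
    a i <= (Num.sqrt m%:R)^-1 * Num.sqrt (E m.+1)
           * (\prod_(m.+1 <= i < m.*2.+1) P i) `^ (m%:R^-1).
Proof.
move=> m_gt0 a0 P0 E0 Edecr aPE; apply: contrapT => /forall2NP.
set Q := _ * Num.sqrt _ * _ => aQ.
have Qa (i : 'I_m) : Q < a (i + m.+1)%N.
  have [|/negP] := aQ (i + m.+1)%N; last by rewrite -ltNge.
  by case; rewrite leq_addl -addnn addnS -addSn leq_add2r ltn_ord.
have Pr0 : 0 <= \prod_(m.+1 <= i < m.*2.+1) P i by apply: prodr_ge0.
have Q0 : 0 <= Q by rewrite !mulr_ge0 ?invr_ge0 ?sqrtr_ge0 ?powR_ge0.
have mn0 : m%:R != 0 :> R by rewrite pnatr_eq0 -lt0n.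
have QE : (Q ^+ 2) ^+ m =
    (\prod_(i < m) P (i + m.+1)%N) ^+ 2 * (E m.+1 / m%:R) ^+ m.
  have -> : Q ^+ 2 = E m.+1 / m%:R
      * ((\prod_(m.+1 <= i < m.*2.+1) P i) `^ (m%:R^-1)) ^+ 2.
    by rewrite /Q !exprMn exprVn !sqr_sqrtr ?ler0n // [_^-1 * _]mulrC.
  rewrite [RHS]mulrC exprMn; congr (_ * _).
  rewrite exprAC; congr (_ ^+ 2).
  by rewrite -powR_mulrn ?powR_ge0 // -powRrM mulVf // powRr1 // prod_nat_double.
(* Strictness of the product uses that the index range is nonempty, that is [m_gt0]. *)
have : (Q ^+ 2) ^+ m < \prod_(i < m) a (i + m.+1)%N ^+ 2.
  rewrite -{1}[m]card_ord -prodr_const; apply: ltr_prod.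
    by rewrite has_predT /index_enum -enumT size_enum_ord.
  by move=> i _; rewrite exprn_ge0 //= ltr_pXn2r // nnegrE.
apply/negP; rewrite -leNgt QE.
apply: (@le_trans _ _ (\prod_(i < m) (P (i + m.+1)%N ^+ 2
                       * (E (i + m.+1)%N - E (i + m.+1).+1)))).
  by apply: ler_prod => i _; rewrite exprn_ge0 //= aPE.
rewrite big_split /= -prodrXl ler_wpM2l ?exprn_ge0 ?prodr_ge0 // => [i _|]; first exact: exprn_ge0.
apply: le_trans (prod_le_mean_exp _) _; first by move=> i; rewrite subr_ge0.
have m0 : (0 : R) < m%:R by rewrite ltr0n.
apply: lerXn2r.
- by rewrite nnegrE divr_ge0 ?sumr_ge0 ?ler0n // => i _; rewrite subr_ge0.
- by rewrite nnegrE divr_ge0 ?ler0n.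
rewrite ler_pM2r ?invr_gt0 //.
(* The drops sum to [E m.+1] minus the energy at index 2m+1, and the latter is nonnegative. *)
rewrite -(big_mkord xpredT (fun i => E (i + m.+1)%N - E (i + m.+1).+1)).
rewrite (eq_bigr (fun i => - (E (i.+1 + m.+1)%N - E (i + m.+1)%N))); last first.
  by move=> i _; rewrite opprB addSn.
by rewrite sumrN (telescope_sumr (fun i => E (i + m.+1)%N)) // opprB gerBl.
Qed.

End Greedy.

(** * Symmetry of mixed second derivatives *)

Section SecondDerivatives.
Context (R : realType) (V : normedModType R).
Implicit Types (f : V -> R) (x u v : V).

(** The bound is written [0 + e] to match the goal left by [ler_addgt0Pr]. *)
Lemma dist_le_add_half (p q c e : R) :
  `|p - c| < e / 2 -> `|q - c| < e / 2 -> `|p - q| <= 0 + e.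
Proof.
move=> pc qc; rewrite add0r [e]splitr (le_trans (ler_distD c _ _)) // lerD ?ltW //.
by rewrite distrC.
Qed.

Lemma is_derive_line f x v (t : R) : derivable f (x + t *: v) v ->
  is_derive t 1 (fun s : R => f (x + s *: v)) ('D_v f (x + t *: v)).
Proof.
move=> df.
have E : (fun h : R => h^-1 *: (f (x + (h *: (1 : R) + t) *: v) - f (x + t *: v)))
       = (fun h : R => h^-1 *: (f (h *: v + (x + t *: v)) - f (x + t *: v))).
  apply/funext => h; do 3!congr (_ _); rewrite scalerDl addrCA.
  by rewrite [h *: 1]mulr1.
apply: DeriveDef; first by rewrite /derivable /= E.
by rewrite /derive /= E.
Qed.

Lemma MVT_line f x v (t : R) : 0 < t ->
  (forall s, 0 <= s <= t -> derivable f (x + s *: v) v) ->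
  exists2 s, 0 <= s <= t & f (x + t *: v) - f x = t * 'D_v f (x + s *: v).
Proof.
move=> t0 df.
have dl s : 0 <= s <= t -> is_derive s 1 (fun s : R => f (x + s *: v)) ('D_v f (x + s *: v)).
  by move=> /df; exact: is_derive_line.
have [||s] := MVT (f := fun s => f (x + s *: v)) (df := fun s => 'D_v f (x + s *: v)) t0.
- by move=> s; rewrite in_itv/= => /andP[/ltW s0 /ltW st]; apply: dl; rewrite s0.
- apply: derivable_within_continuous => s; rewrite in_itv/= => /dl ?.
  exact: ex_derive.
rewrite in_itv/= => /andP[/ltW s0 /ltW st]; rewrite scale0r addr0 subr0 => E.
by exists s; rewrite ?s0 // E mulrC.
Qed.

(** Two uses of the mean value theorem: along [u] for the increment [g] of [f] in direction [v],
    then along [v] for ['D_u f]. *)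
Lemma second_difference f x u v (t : R) : 0 < t ->
  (forall a b, 0 <= a <= t -> 0 <= b <= t ->
    derivable f (x + a *: u + b *: v) u /\
    derivable ('D_u f) (x + a *: u + b *: v) v) ->
  exists a b, [/\ 0 <= a <= t, 0 <= b <= t &
    f (x + t *: u + t *: v) - f (x + t *: u) - f (x + t *: v) + f x
    = t ^+ 2 * 'D_v ('D_u f) (x + a *: u + b *: v)].
Proof.
move=> t0 df; have tt : 0 <= t <= t by rewrite lexx ltW.
have t00 : 0 <= (0 : R) <= t by rewrite lexx ltW.
pose g y := f (y + t *: v) - f y.
have dg a : 0 <= a <= t -> is_derive (x + a *: u) u g
    ('D_u f (x + a *: u + t *: v) - 'D_u f (x + a *: u)).
  move=> at0; have [d1 _] := df a t at0 tt; have [d0 _] := df a 0 at0 t00.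
  rewrite scale0r addr0 in d0.
  apply: is_deriveB; last exact: derivableP.
  have E : (fun h : R => h^-1 *: (f (h *: u + (x + a *: u) + t *: v)
                                  - f (x + a *: u + t *: v)))
    = (fun h : R => h^-1 *: (f (h *: u + (x + a *: u + t *: v))
                                  - f (x + a *: u + t *: v))).
    by apply/funext => h; rewrite !addrA.
  by apply: DeriveDef; rewrite /derivable /derive /= E.
have [a ta ga] : exists2 a, 0 <= a <= t & g (x + t *: u) - g x = t * 'D_u g (x + a *: u).
  exact: (@MVT_line g x u t t0 (fun s ts => @ex_derive _ _ _ _ _ _ _ (dg s ts))).
have [b tb gb] : exists2 b, 0 <= b <= t & 'D_u f (x + a *: u + t *: v) - 'D_u f (x + a *: u)
    = t * 'D_v ('D_u f) (x + a *: u + b *: v).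
  exact: (@MVT_line ('D_u f) (x + a *: u) v t t0 (fun s ts => (df a s ta ts).2)).
exists a, b; split => //; have dga := dg a ta.
by rewrite expr2 -mulrA -gb -(derive_val (is_derive := dga)) -ga /g; ring.
Qed.

(* Schwarz's theorem: both mixed derivatives are limits of the same second
   difference quotient. *)
Lemma derive_comm f x u v :
  (\forall y \near x, [/\ derivable f y u, derivable f y v,
     derivable ('D_u f) y v & derivable ('D_v f) y u]) ->
  {for x, continuous ('D_v ('D_u f))} -> {for x, continuous ('D_u ('D_v f))} ->
  'D_v ('D_u f) x = 'D_u ('D_v f) x.
Proof.
move=> df cuv cvu; apply/eqP; rewrite -subr_eq0 -normr_le0; apply/ler_addgt0Pr => e e0.
have e20 : 0 < e / 2 by rewrite divr_gt0.
have /cvgrPdist_lt/(_ _ e20) nuv := cuv; have /cvgrPdist_lt/(_ _ e20) nvu := cvu.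
pose D2 := 'D_v ('D_u f); pose D2' := 'D_u ('D_v f).
have [r r0 xr] : exists2 r : R, 0 < r & forall y, ball x r y ->
    [/\ derivable f y u, derivable f y v, derivable ('D_u f) y v
      & derivable ('D_v f) y u] /\ (`|D2 x - D2 y| < e / 2 /\ `|D2' x - D2' y| < e / 2).
  by apply/nbhs_ballP; exact: filterI df (filterI nuv nvu).
(* Small enough that the whole parallelogram spanned by [t *: u] and [t *: v] at [x] stays within
   distance r/2; the 1 keeps the denominator positive. *)
pose t := r / (1 + `|u| + `|v|) / 2.
have nu := normr_ge0 u; have nv := normr_ge0 v.
have t0 : 0 < t by rewrite !divr_gt0 // -addrA ltr_wpDr ?addr_ge0.
have ballP a b : 0 <= a <= t -> 0 <= b <= t -> ball x r (x + a *: u + b *: v).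
  move=> /andP[a0 at_] /andP[b0 bt].
  rewrite -ball_normE /ball_ /= distrC -(addrA x) [x + _]addrC addrK.
  apply: (@le_lt_trans _ _ (t * (1 + `|u| + `|v|))).
    apply: (le_trans (ler_normD _ _)); rewrite !normrZ (ger0_norm a0) (ger0_norm b0).
    rewrite !mulrDr -addrA; apply: ler_wpDl; first by rewrite mulr1 ltW.
    by apply: lerD; exact: ler_wpM2r.
  rewrite /t mulrAC divfK; last by rewrite gt_eqF // -addrA ltr_wpDr ?addr_ge0.
  by rewrite ltr_pdivrMr // ltr_pMr // ltr1n.
have [a [b [ta tb E1]]] := second_difference t0
  (fun a b ta tb => let: And4 du _ duv _ := (xr _ (ballP a b ta tb)).1 in conj du duv).
have df' b' a' : 0 <= b' <= t -> 0 <= a' <= t ->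
    derivable f (x + b' *: v + a' *: u) v /\
    derivable ('D_v f) (x + b' *: v + a' *: u) u.
  move=> tb' ta'; rewrite addrAC.
  by case: (xr _ (ballP a' b' ta' tb')).1 => _ dv _ dvu; exact: conj dv dvu.
have [b' [a' [tb' ta' E2]]] := second_difference t0 df'.
have [near1 _] := (xr _ (ballP a b ta tb)).2.
have [_ near2] := (xr _ (ballP a' b' ta' tb')).2.
rewrite [_ + b' *: v + _]addrAC in E2.
(* The second difference is symmetric in [u] and [v], so both mean values agree after division by
   [t ^+ 2]. *)
have E : 'D_v ('D_u f) (x + a *: u + b *: v) = 'D_u ('D_v f) (x + a' *: u + b' *: v).
  have t20 : t ^+ 2 != 0 by rewrite expf_neq0 // gt_eqF.
  apply: (mulfI t20); apply: (etrans (esym E1)); apply: (etrans _ E2).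
  by rewrite [x + t *: v + _]addrAC [f _ - f (x + t *: v) - _]addrAC.
by apply: dist_le_add_half near1 _; rewrite /D2 E.
Qed.

End SecondDerivatives.

(** * Euclidean and spectral norms *)

Section EuclideanNorm.
Context (R : realType) (d : nat).
Implicit Types (a b v : 'rV[R]_d) (A : 'M[R]_d).

Definition dotv a b : R := \sum_i a 0 i * b 0 i.

Lemma vnorm2_ge0 v : 0 <= vnorm2 v.
Proof. exact: sqrtr_ge0. Qed.

Lemma vnorm2_sqr v : vnorm2 v ^+ 2 = dotv v v.
Proof.
rewrite /vnorm2 sqr_sqrtr; last by apply: sumr_ge0 => i _; exact: sqr_ge0.
by apply: eq_bigr => i _; rewrite expr2.
Qed.

Lemma dotv_le a b : dotv a b <= vnorm2 a * vnorm2 b.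
Proof.
have Bge0 : 0 <= dotv b b by rewrite -vnorm2_sqr exprn_ge0 ?vnorm2_ge0.
have [B0|B0] := eqVneq (dotv b b) 0.
  have b0 i : b 0 i = 0.
    move/eqP: B0; rewrite psumr_eq0 => [/allP/(_ i)|j _]; last exact: sqr_ge0.
    by rewrite mem_index_enum mulf_eq0 orbb => /(_ isT)/eqP.
  rewrite {1}/dotv big1 ?mulr_ge0 ?vnorm2_ge0 // => i _; by rewrite b0 mulr0.
have Bgt0 : 0 < dotv b b by rewrite lt_def B0.
have sq : dotv a b ^+ 2 <= dotv a a * dotv b b.
  rewrite -subr_ge0 -(pmulr_rge0 _ Bgt0).
  have expand p q : \sum_i (p * a 0 i - q * b 0 i) ^+ 2 =
      p ^+ 2 * dotv a a - 2 * p * q * dotv a b + q ^+ 2 * dotv b b.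
    rewrite !mulr_sumr -sumrB -big_split /=; apply: eq_bigr => i _; ring.
  (* Lagrange's identity: the Cauchy-Schwarz defect, times [dotv b b], is a sum of squares. *)
  rewrite [leRHS](_ : _ = \sum_i (dotv b b * a 0 i - dotv a b * b 0 i) ^+ 2).
    by apply: sumr_ge0 => i _; exact: sqr_ge0.
  by rewrite expand; ring.
apply: le_trans (ler_norm _) _.
rewrite -(ler_pXn2r (ltn0Sn 1)) ?nnegrE ?mulr_ge0 ?vnorm2_ge0 //.
by rewrite exprMn !vnorm2_sqr -normrX ger0_norm // sqr_ge0.
Qed.

Lemma vnorm2D a b : vnorm2 (a + b) <= vnorm2 a + vnorm2 b.
Proof.
rewrite -(ler_pXn2r (ltn0Sn 1)) ?nnegrE ?addr_ge0 ?vnorm2_ge0 //.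
have -> : vnorm2 (a + b) ^+ 2 = vnorm2 a ^+ 2 + dotv a b *+ 2 + vnorm2 b ^+ 2.
  rewrite !vnorm2_sqr /dotv -sumrMnl -!big_split /=.
  by apply: eq_bigr => i _; rewrite mxE; ring.
by rewrite sqrrD !lerD2r lerD2l lerMn2r dotv_le.
Qed.

Lemma vnorm2Z c v : vnorm2 (c *: v) = `|c| * vnorm2 v.
Proof.
rewrite /vnorm2 -sqrtr_sqr -sqrtrM ?sqr_ge0 // mulr_sumr.
by congr Num.sqrt; apply: eq_bigr => i _; rewrite mxE exprMn.
Qed.

Lemma vnorm2N v : vnorm2 (- v) = vnorm2 v.
Proof. by rewrite -scaleN1r vnorm2Z normrN1 mul1r. Qed.

Lemma vnorm2_le_sqrt c v : (forall i, `|v 0 i| <= c) ->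
  vnorm2 v <= Num.sqrt d%:R * c.
Proof.
(* Nonnegativity of [c] is read off a coordinate, so dimension 0 is treated apart. *)
move=> vc; case: d v vc => [|d'] v vc.
  by rewrite /vnorm2 big_ord0 sqrtr0 mul0r.
have c0 : 0 <= c := le_trans (normr_ge0 _) (vc 0).
rewrite -(ler_pXn2r (ltn0Sn 1)) ?nnegrE ?mulr_ge0 ?sqrtr_ge0 //.
rewrite exprMn !sqr_sqrtr ?ler0n //; last by apply: sumr_ge0 => i _; exact: sqr_ge0.
rewrite mulr_natl -[X in _ *+ X]card_ord -sumr_const; apply: ler_sum => i _.
by rewrite -real_normK ?num_real // lerXn2r ?nnegrE.
Qed.

(** The Frobenius bound; it shows that the set whose [sup] defines [opnorm2] is bounded above. *)
Lemma vnorm2_mulmx_le A v :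
  vnorm2 (v *m A^T) <= Num.sqrt (\sum_i vnorm2 (row i A) ^+ 2) * vnorm2 v.
Proof.
have S0 : 0 <= \sum_i vnorm2 (row i A) ^+ 2 by apply: sumr_ge0 => i _; exact: sqr_ge0.
rewrite -(ler_pXn2r (ltn0Sn 1)) ?nnegrE ?mulr_ge0 ?sqrtr_ge0 ?vnorm2_ge0 //.
rewrite exprMn (sqr_sqrtr S0) vnorm2_sqr mulr_suml; apply: ler_sum => i _.
have E w : (w *m A^T) 0 i = dotv (row i A) w.
  by rewrite mxE; apply: eq_bigr => j _; rewrite !mxE mulrC.
rewrite -exprMn -expr2 -real_normK ?num_real // lerXn2r ?nnegrE ?mulr_ge0 ?vnorm2_ge0 //.
have NE : - (v *m A^T) 0 i = ((- v) *m A^T) 0 i by rewrite mulNmx [RHS]mxE.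
by rewrite ler_norml lerNl NE !E -{1}(vnorm2N v) !dotv_le.
Qed.

Lemma opnorm2_ub A v : vnorm2 (v *m A^T) <= opnorm2 A * vnorm2 v.
Proof.
have [v0|v0] := eqVneq (vnorm2 v) 0.
  by have := vnorm2_mulmx_le A v; rewrite v0 !mulr0.
have vgt0 : 0 < vnorm2 v by rewrite lt_def v0 vnorm2_ge0.
rewrite -ler_pdivrMr //.
have -> : vnorm2 (v *m A^T) / vnorm2 v = vnorm2 (((vnorm2 v)^-1 *: v) *m A^T).
  by rewrite -scalemxAl vnorm2Z ger0_norm ?invr_ge0 ?vnorm2_ge0 // mulrC.
apply: ub_le_sup; last first.
  exists ((vnorm2 v)^-1 *: v) => //=.
  by rewrite vnorm2Z ger0_norm ?invr_ge0 ?vnorm2_ge0 // mulVf.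
exists (Num.sqrt (\sum_i vnorm2 (row i A) ^+ 2)) => _ [w /= w1 <-].
by apply: le_trans (vnorm2_mulmx_le A w) _; rewrite ler_piMr ?sqrtr_ge0.
Qed.

End EuclideanNorm.

(** * Hessian symmetry and a mean value inequality for gradients *)

Section Gradient.
Context (R : realType) (d : nat).
Local Notation V := 'rV[R]_d.
Implicit Types (A : set V) (f : V -> R) (a b v w x : V).

Lemma derive_row_sum f v x : differentiable f x ->
  'D_v f x = \sum_l v 0 l * pd f l x.
Proof.
move=> df; rewrite deriveE // {1}(row_sum_delta v) linear_sum /=.
by apply: eq_bigr => l _; rewrite linearZ /= /pd deriveE.
Qed.

(** Openness of [A] turns continuity within [A] into continuity at [x] and makes differentiability
    hold near [x], as [derive_comm] asks. *)
Lemma hess_sym A f x : open A -> C2_on A f -> A x -> (hess f x)^T = hess f x.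
Proof.
move=> oA [[df _] C2] Ax; apply/matrixP => i j; rewrite !mxE.
have cont (g : V -> R) : {within A, continuous g} -> {for x, continuous g}.
  move=> cg; have := continuous_open_subspace g oA => E; rewrite E in cg.
  by apply: cg; rewrite inE.
apply: derive_comm; last 2 first.
- exact: cont ((C2 i).2 j).
- exact: cont ((C2 j).2 i).
apply: filterS (open_nbhs_nbhs (conj oA Ax)) => y Ay.
have dp l : differentiable (pd f l) y := (C2 l).1 _ Ay.
by split; apply: diff_derivable; [exact: df|exact: df|exact: dp|exact: dp].
Qed.

(** The mean value theorem is scalar, so it is applied to [F], the gradient paired with its own
    increment [w]. This gives the square of [vnorm2 w] as a product [dotv w _], and Cauchy-Schwarz
    cancels one factor. *)
Lemma gradf_dist_le A f a b (M : R) : convex_rv A -> C2_on A f -> A a -> A b ->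
  (forall t, 0 <= t <= 1 -> A (a + t *: (b - a)) ->
     vnorm2 ((b - a) *m hess f (a + t *: (b - a))) <= M) ->
  vnorm2 (gradf f b - gradf f a) <= M.
Proof.
move=> cA [_ C2] Aa Ab hM; set v := b - a in hM *; set w := _ - _.
have seg t : 0 <= t <= 1 -> A (a + t *: v).
  move=> t01; rewrite (_ : _ + _ = (1 - t) *: a + t *: b); first exact: cA.
  by rewrite /v scalerBr scalerBl scale1r addrA addrAC.
pose F : V -> R := \sum_j (w 0 j *: pd f j).
have dF x : A x -> is_derive x v F (dotv w (v *m hess f x)).
  move=> Ax; apply: is_derive_eq.
    apply: is_derive_sum => j; apply: is_deriveZ; apply: derivableP.
    by apply: diff_derivable; exact: (C2 j).1.
  apply: eq_bigr => j _; congr (_ * _); rewrite derive_row_sum; last exact: (C2 j).1.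
  by rewrite [RHS]mxE; apply: eq_bigr => l _; rewrite [hess f x l j]mxE.
have [s s01] : exists2 s, 0 <= s <= 1 &
    F (a + 1 *: v) - F a = 1 * 'D_v F (a + s *: v).
  apply: (@MVT_line _ _ F a v 1 ltr01) => s s01.
  exact: (@ex_derive _ _ _ _ _ _ _ (dF _ (seg s s01))).
rewrite mul1r (derive_val (is_derive := dF _ (seg s s01))) scale1r.
rewrite [a + v]addrC subrK.
have -> : F b - F a = dotv w w.
  rewrite /F !fct_sumE -sumrB; apply: eq_bigr => j _ /=.
  by rewrite -mulrBr !mxE.
rewrite -vnorm2_sqr => ww.
have hs := hM s s01 (seg s s01).
have [w0|w0] := eqVneq (vnorm2 w) 0; first by rewrite w0 (le_trans (vnorm2_ge0 _) hs).
have wgt0 : 0 < vnorm2 w by rewrite lt_def w0 vnorm2_ge0.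
apply: le_trans hs; rewrite -(ler_pM2l wgt0) -expr2 ww; exact: dotv_le.
Qed.

End Gradient.

(** * Isometry of J and the matrix form of [I2] *)

Section Symplectic.
Context (R : realType) (n : nat).
Implicit Types v : 'rV[R]_(n + n).

Lemma vnorm2_Japp v : vnorm2 (Japp v) = vnorm2 v.
Proof.
rewrite -[v in LHS]hsubmxK /Japp /Jmx tr_block_mx mul_row_block !trmx0 !mulmx0.
rewrite linearN /= !trmx1 mulmxN !mulmx1 add0r addr0 /vnorm2 !big_split_ord /= addrC.
congr Num.sqrt; congr (_ + _); apply: eq_bigr => i _.
  by rewrite row_mxEr mxE sqrrN mxE.
by rewrite row_mxEl mxE.
Qed.

Lemma JappB v w : Japp (v - w) = Japp v - Japp w.
Proof. exact: mulmxBl. Qed.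

Lemma I2_mulmx v : I2 v = v *m (I2mx R n)^T.
Proof.
rewrite -[v in RHS]hsubmxK /I2mx tr_block_mx mul_row_block !trmx0 !mulmx0.
by rewrite trmx1 mulmx1 !addr0 add0r.
Qed.

End Symplectic.

(** * Decay of the greedy gradient errors *)

Section GreedyRate.
Context (R : realType) (d : nat).
Local Notation V := 'rV[R]_d.
Context (Om : set V) (k : V -> V -> R) (H : set (V -> R)).
Context (ip : (V -> R) -> (V -> R) -> R).
Hypothesis rkH : is_RKHS Om k H ip.
Hypothesis dkH : deriv_reproducing Om k H ip.
Context (u : V -> R) (xs : nat -> V) (ls : nat -> 'I_d).
Hypothesis Hu : H u.
Hypothesis greedy : fgreedy Om ip k u xs ls.

Local Notation e := (err ip k xs ls u).
Local Notation s := (surr ip k xs ls u).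
Local Notation G := (gsel k xs ls).

Lemma gsel_RKHS m i : (1 <= i <= m)%N -> H (G i).
Proof. by case: i => // i _; exact: (dkH _ (greedy i).1).1. Qed.

Lemma surr_RKHS m : H (s m).
Proof.
have HG := @gsel_RKHS m.
exact: (in_span_RKHS rkH HG (projP rkH HG Hu).1).
Qed.

Lemma err_RKHS m : H (e m).
Proof. exact: (RKHS_sub rkH Hu (surr_RKHS m)). Qed.

(** Additivity of the partial derivatives comes from [deriv_reproducing], which writes each one as
    an inner product. *)
Lemma gradf_err m x : Om x -> gradf (e m) x = gradf u x - gradf (s m) x.
Proof.
move=> Omx; apply/rowP => l; rewrite !mxE.
have [Hg rep] := dkH l Omx.
rewrite (rep _ (err_RKHS m)) (rep _ Hu) (rep _ (surr_RKHS m)).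
exact: (ip_subl rkH Hu (surr_RKHS m) Hg).
Qed.

(** The greedy pair dominates every partial derivative at every point, so passing from coordinates
    to the Euclidean norm costs only the square root of the dimension. *)
Lemma Linf_grad_err_le m : (Linf_grad Om (e m) <=
  (Num.sqrt d%:R * `|pd (e m) (ls m.+1) (xs m.+1)|)%:E)%E.
Proof.
apply: ge_ereal_sup => _ [x Omx <-]; rewrite lee_fin.
by apply: vnorm2_le_sqrt => l; rewrite mxE; exact: (greedy m).2.
Qed.

Lemma exists_err_derivative_le m : (0 < m)%N ->
  exists2 i, (m.+1 <= i <= m.*2)%N &
    `|pd (e i) (ls i.+1) (xs i.+1)| <=
    (Num.sqrt m%:R)^-1 * rnorm ip (e m.+1)
    * (\prod_(m.+1 <= i < m.*2.+1) power ip k xs ls i (xs i.+1) (ls i.+1))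
      `^ (m%:R^-1).
Proof.
(* The energies are squared norms, and step [i] pairs [e i] with the generator selected at
   [i.+1]. *)
move=> m0; apply: (@exists_le_geometric_mean R
  (fun i => `|pd (e i) (ls i.+1) (xs i.+1)|)
  (fun i => power ip k xs ls i (xs i.+1) (ls i.+1))
  (fun i => ip (e i) (e i))) => // i.
- exact: sqrtr_ge0.
- exact: (ip_ge0 rkH (err_RKHS i)).
- exact: (proj_errS_le rkH (@gsel_RKHS i.+1) Hu).
- have [Hg rep] := dkH (ls i.+1) (greedy i).1.
  rewrite real_normK ?num_real // rep; last exact: err_RKHS.
  rewrite /power /rnorm sqr_sqrtr; last first.
    apply: (ip_ge0 rkH); apply: (RKHS_sub rkH) => //.
    apply: (in_span_RKHS rkH (@gsel_RKHS i)).
    exact: (projP rkH (@gsel_RKHS i) Hg).1.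
  exact: (proj_err_decay rkH (@gsel_RKHS i.+1) Hu).
Qed.

End GreedyRate.

(** * Error of the implicit map *)

Theorem theorem2 (R : realType) (n : nat) (dT : R)
  (D : set 'rV[R]_(n + n)) (Ham : 'rV[R]_(n + n) -> R)
  (Phi : 'rV[R]_(n + n) -> 'rV[R]_(n + n))
  (k : 'rV[R]_(n + n) -> 'rV[R]_(n + n) -> R)
  (H : set ('rV[R]_(n + n) -> R))
  (ip : ('rV[R]_(n + n) -> R) -> ('rV[R]_(n + n) -> R) -> R)
  (S : 'rV[R]_(n + n) -> R)
  (xs : nat -> 'rV[R]_(n + n)) (ls : nat -> 'I_(n + n))
  (im : nat -> nat) (K : set 'rV[R]_(n + n)) (M0 : nat) (LS : R) :
  0 < dT ->
  hamiltonian_flow Ham dT D Phi ->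
  open (Omega D Phi) -> convex_rv (Omega D Phi) ->
  (* kernel and RKHS assumptions *)
  spd_kernel (Omega D Phi) k ->
  kernel_C2 (Omega D Phi) k ->
  is_RKHS (Omega D Phi) k H ip ->
  deriv_reproducing (Omega D Phi) k H ip ->
  (* S is a type II generating function in C^2(Omega) cap H_k(Omega) *)
  H S -> C2_on (Omega D Phi) S -> type2_genfun D Phi dT S ->
  (* greedy algorithm with u := S *)
  fgreedy (Omega D Phi) ip k S xs ls ->
  (* choice of i_m *)
  (forall m : nat, (1 <= m)%N ->
     (m.+1 <= im m <= m.*2)%N /\
     forall i : nat, (m.+1 <= i <= m.*2)%N ->
       (Linf_grad (Omega D Phi) (err ip k xs ls S (im m))
          <= Linf_grad (Omega D Phi) (err ip k xs ls S i))%E) ->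
  compact K -> K `<=` D ->
  (* (i) uniform solvability, for all m >= M0 *)
  (forall m : nat, (M0 <= m)%N -> forall x0, K x0 ->
     (Omega D Phi (I1 x0 + I2 (Phi x0)) /\
      Phi x0 = x0 + dT *: Japp (gradf S (I1 x0 + I2 (Phi x0))) /\
      forall y, Omega D Phi (I1 x0 + I2 y) ->
        y = x0 + dT *: Japp (gradf S (I1 x0 + I2 y)) -> y = Phi x0) /\
     (exists! y, Omega D Phi (I1 x0 + I2 y) /\
        y = x0 + dT *: Japp (gradf (surr ip k xs ls S (im m)) (I1 x0 + I2 y)))) ->
  (* (ii) uniform Lipschitz continuity in y *)
  0 < LS ->
  ereal_sup [set (opnorm2 (hess S (I1 z.1 + I2 z.2) *m I2mx R n))%:E
            | z in [set z : 'rV[R]_(n + n) * 'rV[R]_(n + n) |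
                     K z.1 /\ Omega D Phi (I1 z.1 + I2 z.2)]] = LS%:E ->
  dT < LS^-1 ->
  exists C : R, 0 < C /\
    forall m : nat, (M0 <= m)%N -> (1 <= m)%N ->
    forall x0 y, K x0 -> Omega D Phi (I1 x0 + I2 y) ->
      y = x0 + dT *: Japp (gradf (surr ip k xs ls S (im m)) (I1 x0 + I2 y)) ->
      vnorm2 (y - Phi x0)
        <= C * dT * Num.sqrt (n + n)%:R * (Num.sqrt m%:R)^-1
           * rnorm ip (err ip k xs ls S m.+1)
           * (\prod_(m.+1 <= i < m.*2.+1) power ip k xs ls i (xs i.+1) (ls i.+1))
             `^ (m%:R^-1).

Proof.
move=> dT0 _ oOm cOm _ _ rkH dkH HS C2S _ greedy Him _ KD Hsolv LS0 HLS dTLS.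
have dTLS1 : 0 < 1 - dT * LS by rewrite subr_gt0 -ltr_pdivlMr // div1r.
set Om := Omega D Phi in oOm cOm rkH dkH C2S greedy Him Hsolv HLS *.
exists (1 - dT * LS)^-1; split=> [|m M0m m1 x0 y Kx0 Omy yE]; first by rewrite invr_gt0.
have [[Omy' [y'E _]] _] := Hsolv m M0m x0 Kx0.
set z := I1 x0 + I2 y in Omy yE; set z' := I1 x0 + I2 (Phi x0) in Omy' y'E.
have zz' : z - z' = I2 (y - Phi x0).
  by rewrite /z /z' !I2_mulmx mulmxBl opprD addrACA subrr add0r.
have lip : vnorm2 (gradf S z - gradf S z') <= LS * vnorm2 (y - Phi x0).
  apply: (gradf_dist_le cOm C2S Omy' Omy) => t _ Omt.
  (* Symmetry of the Hessian and [I2_mulmx] rewrite the row product as the action of [hess *m I2mx],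
     the matrix bounded in (ii). *)
  rewrite -(hess_sym oOm C2S Omt) zz' I2_mulmx -mulmxA -trmx_mul.
  apply: le_trans (opnorm2_ub _ _) _; apply: ler_wpM2r; first exact: vnorm2_ge0.
  (* Both endpoints share the component [I1 x0], so each point of the segment has the form over
     which the supremum in (ii) is taken. *)
  have tE : z' + t *: (I2 (y - Phi x0)) = I1 x0 + I2 (Phi x0 + t *: (y - Phi x0)).
    by rewrite /z' !I2_mulmx [in RHS]mulmxDl -scalemxAl addrA.
  rewrite zz' tE in Omt; rewrite -I2_mulmx tE -lee_fin -HLS.
  by apply: ereal_sup_ubound; exists (x0, Phi x0 + t *: (y - Phi x0)).
have [i mi ai] := exists_err_derivative_le rkH dkH HS greedy m1.
set Q := _ * _ * _ in ai.
have eQ : vnorm2 (gradf (err ip k xs ls S (im m)) z) <= Num.sqrt (n + n)%:R * Q.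
  rewrite -lee_fin.
  apply: (@le_trans _ _ (Linf_grad Om (err ip k xs ls S (im m)))).
    by apply: ereal_sup_ubound; exists z.
  (* The index [i] found by AM-GM may differ from [im m]; minimality of [im m] transfers the
     bound. *)
  apply: (le_trans ((Him m m1).2 i mi)).
  apply: (le_trans (Linf_grad_err_le greedy i)).
  by rewrite lee_fin ler_wpM2l ?sqrtr_ge0.
have gE := gradf_err rkH dkH HS greedy (im m) Omy.
have yy' : vnorm2 (y - Phi x0) <= dT * (LS * vnorm2 (y - Phi x0) + Num.sqrt (n + n)%:R * Q).
  (* At [z] the surrogate gradient is that of [S] minus that of the error, so the difference splits
     into a Lipschitz term and an error term. *)
  have yy'E : y - Phi x0 = dT *: Japp ((gradf S z - gradf S z')
      - gradf (err ip k xs ls S (im m)) z).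
    rewrite {1}yE {1}y'E gE opprD addrACA subrr add0r -scalerBr -JappB.
    by congr (_ *: Japp _); rewrite opprB [RHS]addrC addrA subrK.
  rewrite {1}yy'E vnorm2Z vnorm2_Japp gtr0_norm // ler_pM2l //.
  apply: le_trans (vnorm2D _ _) _; rewrite vnorm2N; exact: lerD.
rewrite [leRHS](_ : _ = (1 - dT * LS)^-1 * (dT * (Num.sqrt (n + n)%:R * Q))).
  2: by rewrite /Q !mulrA.
(* Moving the Lipschitz term to the left leaves the factor [1 - dT * LS], positive by [dTLS1]. *)
rewrite ler_pdivlMl //.
have -> : dT * (Num.sqrt (n + n)%:R * Q) = dT * (LS * vnorm2 (y - Phi x0)
  + Num.sqrt (n + n)%:R * Q) - dT * LS * vnorm2 (y - Phi x0) by ring.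
by rewrite mulrBl mul1r lerD2r.
Qed.
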